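(* Let $p:\mathbb{R}^l\to\mathbb{R}$ be a polynomial in $l$ variables with Lipschitz constant $L_p$ on $\mathbf{u}=[0,1]^l$, and consider the problem $$\min_{x\in\mathbf{u}} p(x).$$ Assume that its optimal solutions are not on the boundary of $\mathbf{u}$. Let $\epsilon>0$ be the optimality tolerance and $\delta>0$ the step tolerance. Then the maximum number of iterations of the Parallel Constrained Bernstein Algorithm (PCBA) needed to solve this problem up to accuracy $\epsilon$ and $\delta$ (that is, to meet the stopping criterion given in the context) is $$N=\left\lceil \max\left\{-\log_2\delta,\; -\tfrac12\log_2\!\left(\frac{\epsilon}{4\zeta_p}\right),\; -\log_2\!\left(\frac{\epsilon}{2L_p\sqrt{l}}\right)\right\}\right\rceil,$$ where $\zeta_p$ is the Bernstein range-error constant of $p$ (defined in the context) and $\lceil\cdot\rceil$ rounds up to the nearest integer.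
   Context: Boxes and Bernstein patches. A box is $\mathbf{x}=[\underline{x}_1,\overline{x}_1]\times\cdots\times[\underline{x}_l,\overline{x}_l]\subset\mathbb{R}^l$ with $\underline{x}_\mu<\overline{x}_\mu$; its maximum width is $|\mathbf{x}|=\max_\mu(\overline{x}_\mu-\underline{x}_\mu)$; $\mathbf{u}=[0,1]^l$. The multi-degree $N=(n_1,\dots,n_l)$ of a polynomial $p$ records the largest power of each variable occurring in $p$. Over a box $\mathbf{x}$, $p$ is uniquely written $p(x)=\sum_{0\le J\le N}B_J^{(N)}(\mathbf{x})\,b_J^{(N)}(\mathbf{x},x)$, with $b_J^{(N)}(\mathbf{x},x)=\prod_{\mu=1}^l\binom{n_\mu}{j_\mu}\frac{(x_\mu-\underline{x}_\mu)^{j_\mu}(\overline{x}_\mu-x_\mu)^{n_\mu-j_\mu}}{(\overline{x}_\mu-\underline{x}_\mu)^{n_\mu}}$. The array of Bernstein coefficients $B_p(\mathbf{x})=(B_J^{(N)}(\mathbf{x}))_{J\le N}$ is the (Bernstein) patch of $p$ over $\mathbf{x}$; $\min B_p(\mathbf{x})$ and $\max B_p(\mathbf{x})$ are its smallest and largest entries. Constant $\zeta_p$: a non-negative constant associated with $p$ such that for every $n\in\mathbb{N}$ and every box $\mathbf{x}\subset\mathbf{u}$ of maximum width $2^{-n}$: $\min B_p(\mathbf{x})\le\min_{\mathbf{x}}p\le\min B_p(\mathbf{x})+\zeta_p2^{-2n}$ and $\max B_p(\mathbf{x})-\zeta_p2^{-2n}\le\max_{\mathbf{x}}p\le\max B_p(\mathbf{x})$.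 PCBA for the problem $\min_{x\in\mathbf{u}}p(x)$ (all points of $\mathbf{u}$ feasible). The algorithm maintains a list $\mathcal{L}$ of subboxes of $\mathbf{u}$ with their patches, starting with $\mathcal{L}=\{\mathbf{u}\}$. In each iteration, for $r=1,\dots,l$ in turn: every box in $\mathcal{L}$ is replaced by its two halves obtained by bisecting it in the $r$-th direction (with the corresponding patches), and then the cut-off test is applied: with $p^*_{\mathrm{up}}=\min_{\mathbf{x}\in\mathcal{L}}\max B_p(\mathbf{x})$, every $\mathbf{x}\in\mathcal{L}$ that is suboptimal, i.e. $\min B_p(\mathbf{x})>p^*_{\mathrm{up}}$, is removed. Thus after $n$ iterations every box in $\mathcal{L}$ has width $2^{-n}$. Stopping criterion: there is $\mathbf{x}\in\mathcal{L}$ with $|\mathbf{x}|\le\delta$ and $\max B_p(\mathbf{x})-\min B_p(\mathbf{y})\le\epsilon$ for all $\mathbf{y}\in\mathcal{L}$. User-imposed caps on memory and iteration count are disregarded.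
   Formalization: The iteration count is bounded by max(0, N) instead of N, since N is negative for large tolerances (for example δ > 1 and ε large), where no number of iterations can be at most N; for N ≥ 0 nothing changes. *)

(* Defs.v *)
From HB Require Import structures.
From mathcomp Require Import all_boot all_order all_algebra.
From mathcomp Require Import all_classical all_reals all_analysis.
(* Not imported: its notations clash with those of mathcomp-analysis. *)
From mathcomp Require mpoly.
Import numFieldNormedType.Exports.

Set Implicit Arguments.
Unset Strict Implicit.
Unset Printing Implicit Defensive.

Import Order.TTheory GRing.Theory Num.Theory.

Local Open Scope classical_set_scope.
Local Open Scope ring_scope.

(* Points of R^l are row vectors 'rV[R]_l: their topology is the usual one,
   but their library norm is the sup norm. *)

Definition peval (R : realType) (l : nat) (p : mpoly.mpoly l R)
    (x : 'rV[R]_l) : R :=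
  mpoly.meval (fun i => x 0 i) p.

Definition norm2 (R : realType) (l : nat) (x : 'rV[R]_l) : R :=
  Num.sqrt (\sum_i x 0 i ^+ 2).

(* Only proper boxes (lower corner strictly below the upper one) are
   meaningful. *)
Definition box (R : realType) (l : nat) : Type := ('rV[R]_l * 'rV[R]_l)%type.

Definition lo (R : realType) (l : nat) (x : box R l) (i : 'I_l) : R := x.1 0 i.

Definition hi (R : realType) (l : nat) (x : box R l) (i : 'I_l) : R := x.2 0 i.

Definition proper_box (R : realType) (l : nat) (x : box R l) : Prop :=
  forall i, lo x i < hi x i.

Definition box_set (R : realType) (l : nat) (x : box R l) : set 'rV[R]_l :=
  [set y | forall i, lo x i <= y 0 i <= hi x i].

Definition width (R : realType) (l : nat) (x : box R l) : R :=
  \big[Num.max/0]_i (hi x i - lo x i).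

Definition unit_box (R : realType) (l : nat) : box R l :=
  (const_mx 0, const_mx 1).

Definition lipschitz_constant (R : realType) (l : nat) (p : mpoly.mpoly l R)
    (L : R) : Prop :=
  0 <= L /\
  forall x y, box_set (unit_box R l) x -> box_set (unit_box R l) y ->
    `|peval p x - peval p y| <= L * norm2 (x - y).

Definition boundary (R : realType) (l : nat) (A : set 'rV[R]_l) :
    set 'rV[R]_l :=
  closure A `\` A°.

Definition optimal_solution (R : realType) (l : nat) (p : mpoly.mpoly l R)
    (x : 'rV[R]_l) : Prop :=
  box_set (unit_box R l) x /\
  forall y, box_set (unit_box R l) y -> peval p x <= peval p y.

Definition multi_degree (R : realType) (l : nat) (p : mpoly.mpoly l R)
    (i : 'I_l) : nat :=
  (\max_(m <- mpoly.msupp p) mpoly.fun_of_multinom m i)%N.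

(* The multi-indices J with 0 <= J <= N. *)
Definition multi_index (l : nat) (N : 'I_l -> nat) : finType :=
  {dffun forall i : 'I_l, 'I_(N i).+1}.

Definition bernstein_basis (R : realType) (l : nat) (N : 'I_l -> nat)
    (J : multi_index N) (x : box R l) (y : 'rV[R]_l) : R :=
  \prod_i ('C(N i, J i)%:R *
    ((y 0 i - lo x i) ^+ J i * (hi x i - y 0 i) ^+ (N i - J i)%N
     / (hi x i - lo x i) ^+ N i)).

Definition patch (R : realType) (l : nat) (p : mpoly.mpoly l R) : Type :=
  {ffun multi_index (multi_degree p) -> R}.

Definition is_bernstein_patch (R : realType) (l : nat) (p : mpoly.mpoly l R)
    (x : box R l) (B : patch p) : Prop :=
  forall y, peval p y = \sum_J B J * bernstein_basis J x y.

(* The unique coefficient array expanding p in the Bernstein basis over x; the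
   default value 0 is irrelevant, since this array exists for proper boxes. *)
Definition bernstein_patch (R : realType) (l : nat) (p : mpoly.mpoly l R)
    (x : box R l) : patch p :=
  xget [ffun=> 0] [set B : {ffun multi_index (multi_degree p) -> R}
                  | is_bernstein_patch x (B : patch p)].

(* Meant for nonempty sequences; 0 on the empty one. *)
Definition seq_min (R : realType) (s : seq R) : R :=
  \big[Num.min/head 0 s]_(a <- s) a.

Definition seq_max (R : realType) (s : seq R) : R :=
  \big[Num.max/head 0 s]_(a <- s) a.

Definition min_patch (R : realType) (l : nat) (p : mpoly.mpoly l R)
    (x : box R l) : R :=
  seq_min (codom (bernstein_patch p x)).

Definition max_patch (R : realType) (l : nat) (p : mpoly.mpoly l R)
    (x : box R l) : R :=
  seq_max (codom (bernstein_patch p x)).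

(* The extrema of p over the compact box x are written as inf and sup. *)
Definition range_error_constant (R : realType) (l : nat)
    (p : mpoly.mpoly l R) (zeta : R) : Prop :=
  0 <= zeta /\
  forall (n : nat) (x : box R l),
    proper_box x -> box_set x `<=` box_set (unit_box R l) ->
    width x = 2 ^- n ->
    [/\ min_patch p x <= inf (peval p @` box_set x),
        inf (peval p @` box_set x) <= min_patch p x + zeta * 2 ^- (2 * n),
        max_patch p x - zeta * 2 ^- (2 * n) <= sup (peval p @` box_set x) &
        sup (peval p @` box_set x) <= max_patch p x].

Definition set_coord (R : realType) (l : nat) (v : 'rV[R]_l) (r : 'I_l)
    (a : R) : 'rV[R]_l :=
  \row_i (if i == r then a else v 0 i).

Definition bisect (R : realType) (l : nat) (r : 'I_l) (x : box R l) :
    seq (box R l) :=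
  let mid := (lo x r + hi x r) / 2 in
  [:: (x.1, set_coord x.2 r mid); (set_coord x.1 r mid, x.2)].

Definition p_up (R : realType) (l : nat) (p : mpoly.mpoly l R)
    (L : seq (box R l)) : R :=
  seq_min [seq max_patch p x | x <- L].

Definition suboptimal (R : realType) (l : nat) (p : mpoly.mpoly l R)
    (L : seq (box R l)) (x : box R l) : bool :=
  p_up p L < min_patch p x.

Definition cut_off (R : realType) (l : nat) (p : mpoly.mpoly l R)
    (L : seq (box R l)) : seq (box R l) :=
  [seq x <- L | ~~ suboptimal p L x].

Definition pcba_iteration (R : realType) (l : nat) (p : mpoly.mpoly l R)
    (L : seq (box R l)) : seq (box R l) :=
  foldl (fun L' r => cut_off p (flatten [seq bisect r x | x <- L']))
    L (enum 'I_l).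

Definition pcba_list (R : realType) (l : nat) (p : mpoly.mpoly l R)
    (n : nat) : seq (box R l) :=
  iter n (pcba_iteration p) [:: unit_box R l].

Definition stopping_criterion (R : realType) (l : nat) (p : mpoly.mpoly l R)
    (eps delta : R) (L : seq (box R l)) : Prop :=
  exists x, [/\ x \in L, width x <= delta &
    forall y, y \in L -> max_patch p x - min_patch p y <= eps].

(* The algorithm performs exactly T iterations: the stopping criterion is met
   after T of them, and not before. *)
Definition pcba_iterations (R : realType) (l : nat) (p : mpoly.mpoly l R)
    (eps delta : R) (T : nat) : Prop :=
  stopping_criterion p eps delta (pcba_list p T) /\
  forall k, (k < T)%N -> ~ stopping_criterion p eps delta (pcba_list p k).

Definition elog2 (R : realType) (x : \bar R) : \bar R :=
  (lne x * ((ln 2)^-1)%:E)%E.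

(* Extended reals handle zeta = 0 and L = 0: there a / 0 = +oo for a > 0 and
   the corresponding term of the maximum is -oo.  The maximum itself is always
   finite when delta > 0, because of its first term. *)
Definition pcba_bound (R : realType) (l : nat) (zeta L eps delta : R) : int :=
  Num.ceil (fine
    (maxe (- elog2 delta%:E)
    (maxe (- ((2^-1)%:E * elog2 (eps%:E / (4 * zeta)%:E)))
          (- elog2 (eps%:E / (2 * L * Num.sqrt l%:R)%:E)))))%E.

(* Main.v *)
Require Import Defs.
From HB Require Import structures.
From mathcomp Require Import all_boot all_order all_algebra.
From mathcomp Require Import all_classical all_reals all_analysis.
From mathcomp Require mpoly.
From mathcomp Require Import ring lra.
Import numFieldNormedType.Exports.

Set Implicit Arguments.
Unset Strict Implicit.
Unset Printing Implicit Defensive.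

Import Order.TTheory GRing.Theory Num.Theory.
Local Open Scope classical_set_scope.
Local Open Scope ring_scope.

(** Fix a minimizer [c] of [p] over the unit box [u]; it exists because [p] is
    continuous and [u] compact.  Two facts give the bound.

    A box that contains [c] is never cut off.  Its smallest Bernstein
    coefficient is at most [p c], while each box of the list contains a point
    of [u] where [p] is at most the largest coefficient, so that the cut-off
    value [p_up] is at least [p c] ([optimum_le_p_up]).  Bisecting a box that
    contains [c] leaves a half that contains [c].  Hence the list always has a
    box around [c], also between the bisections of one iteration; this is
    [grid_around], proved by induction over the directions and the iterations
    ([grid_around_pcba_list]).

    After [n] iterations all boxes have width [2 ^- n].  If [x] is the box
    around [c] and [y] any box of the list, then
[[
      max_patch x <= sup_x p + zeta 4^-n <= p c + L sqrt l 2^-n + zeta 4^-n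
      min_patch y >= inf_y p - zeta 4^-n >= p c - zeta 4^-n,
]]
    the Lipschitz bound applying because [x] has Euclidean diameter at most
    [sqrt l 2^-n].  The gap is therefore at most
    [2 zeta 4^-n + L sqrt l 2^-n], and the criterion holds as soon as each of
    these two terms is at most [eps / 2] and [2^-n <= delta]
    ([stopping_criterion_fine_grid]).  Taking logarithms, these three
    inequalities say that [n] is at least the bound ([pcba_bound_le]).  The
    number of iterations is the least [n] for which the criterion holds.

    Inside one iteration the boxes are not cubes, but their sides are still
    powers of [1/2], and so is their width: the range-error property applies
    to them and gives the enclosure of [p] that the cut-off argument needs
    ([patch_encloses]). *)

(** * Extrema of a polynomial over the unit box *)

Lemma peval_continuous (R : realType) (l : nat) (p : mpoly.mpoly l R) :
  continuous (peval p).
Proof.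
have -> : peval p = fun x => \sum_(m <- mpoly.msupp p)
    mpoly.mcoeff m p * \prod_i x 0 i ^+ mpoly.fun_of_multinom m i.
  by apply/funext => x; rewrite /peval mpoly.mevalE.
have monomial_continuous (m : mpoly.multinom l) : continuous
    (fun x : 'rV[R]_l => \prod_i x 0 i ^+ mpoly.fun_of_multinom m i).
  apply: (@continuous_big _ _ _ _ _ (@mul_continuous R)) => i _ x.
  exact: (continuous_comp (@coord_continuous R 1 l 0 i x)
            (@exprn_continuous R _ _)).
apply: (@continuous_big _ _ _ _ _ (@add_continuous R^o)) => m _ x.
exact: (continuousM (@cst_continuous _ _ _ x) (monomial_continuous m x)).
Qed.

Lemma unit_box_coord (R : realType) (l : nat) (y : 'rV[R]_l) :
  box_set (unit_box R l) y <-> forall i, 0 <= y 0 i <= 1.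
Proof.
by rewrite /box_set /lo /hi /=; split=> h i; move: (h i); rewrite !mxE.
Qed.

Lemma unit_box_compact (R : realType) (l : nat) :
  compact (box_set (unit_box R l)).
Proof.
have -> : box_set (unit_box R l) =
    [set v : 'rV[R]_l | forall i, `[0, 1]%classic (v ord0 i)].
  apply/seteqP; split=> v /=.
    by move/unit_box_coord => h i; rewrite in_itv /=.
  by move=> h; apply/unit_box_coord => i; have := h i; rewrite in_itv.
apply: (@rV_compact R l (fun=> `[0, 1]%classic)) => i.
exact: segment_compact.
Qed.

Lemma unit_box_neq0 (R : realType) (l : nat) :
  box_set (unit_box R l) !=set0.
Proof.
exists (const_mx 0); apply/unit_box_coord => i; rewrite mxE; lra.
Qed.

Lemma ex_optimal_solution (R : realType) (l : nat) (p : mpoly.mpoly l R) :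
  exists x, optimal_solution p x.
Proof.
have [|c cu cmin] := EVT_min_rV (unit_box_neq0 R l) (@unit_box_compact R l)
  (f := peval p); first by apply: continuous_subspaceT; exact: peval_continuous.
by exists c; split=> [|y yu]; [exact: set_mem|apply/cmin/mem_set].
Qed.

Lemma peval_unit_box_bounded (R : realType) (l : nat) (p : mpoly.mpoly l R) :
  exists M, forall y, box_set (unit_box R l) y -> peval p y <= M.
Proof.
have [|c cu cmax] := EVT_max_rV (unit_box_neq0 R l) (@unit_box_compact R l)
  (f := peval p); first by apply: continuous_subspaceT; exact: peval_continuous.
by exists (peval p c) => y yu; apply/cmax/mem_set.
Qed.

(** * Euclidean norm and minimum of a sequence *)

Lemma le_norm2 (R : realType) (l : nat) (v : 'rV[R]_l) (a : R) :
  0 <= a -> (forall i, `|v 0 i| <= a) -> norm2 v <= a * Num.sqrt l%:R.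
Proof.
move=> a0 va; rewrite /norm2 -(ger0_norm a0) -sqrtr_sqr -sqrtrM ?sqr_ge0//.
apply: ler_wsqrtr; apply: (@le_trans _ _ (\sum_(i < l) a ^+ 2)).
  by apply: ler_sum => i _; rewrite -real_normK ?num_real// lerXn2r ?nnegrE.
by rewrite sumr_const card_ord mulr_natr.
Qed.

(** The sequence must be nonempty: on the empty one [seq_min] is [0]. *)
Lemma le_seq_min (R : realType) (s : seq R) (c : R) :
  s != [::] -> (forall a, a \in s -> c <= a) -> c <= seq_min s.
Proof.
case: s => // b s _ h; rewrite /seq_min big_seq; apply: le_bigmin => //.
by rewrite h// mem_head.
Qed.

(** * Boxes with dyadic sides *)

(** The exponent may depend on the direction because the cut-off test is also
    run in the middle of an iteration, when only some directions have been
    bisected. *)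
Definition dyadic_box (R : realType) (l : nat) (d : 'I_l -> nat)
    (x : box R l) : Prop :=
  box_set x `<=` box_set (unit_box R l) /\
  forall i, hi x i - lo x i = 2 ^- d i.

Lemma dyadic_proper (R : realType) (l : nat) (d : 'I_l -> nat) (x : box R l) :
  dyadic_box d x -> proper_box x.
Proof. by case=> _ h i; rewrite -subr_gt0 h invr_gt0 exprn_gt0. Qed.

Lemma dyadic_width (R : realType) (l : nat) (d : 'I_l -> nat) (x : box R l)
    (i0 : 'I_l) :
  dyadic_box d x -> (forall i, (d i0 <= d i)%N) -> width x = 2 ^- d i0.
Proof.
case=> _ h dmin; apply/le_anti/andP; split; last first.
  by rewrite -h; exact: (le_bigmax _ (fun i => hi x i - lo x i)).
apply: bigmax_le => [|i _]; first by rewrite invr_ge0 exprn_ge0.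
by rewrite h lef_pV2 ?posrE ?exprn_gt0// ler_weXn2l// ler1n.
Qed.

(** The widest side is the one with the least exponent.  With no direction at
    all the width would be [0], whence the assumption on [l]. *)
Lemma dyadic_width_pow (R : realType) (l : nat) (d : 'I_l -> nat)
    (x : box R l) :
  (0 < l)%N -> dyadic_box d x -> exists n, width x = 2 ^- n.
Proof.
case: l d x => // l d x _ dx; exists (d [arg min_(i < ord0) d i]%N).
by apply: dyadic_width => // i; case: arg_minnP => // j _; apply.
Qed.

Lemma dyadic_lower_corner (R : realType) (l : nat) (d : 'I_l -> nat)
    (x : box R l) :
  dyadic_box d x -> box_set x x.1.
Proof.
by move=> dx i; have := dyadic_proper dx i; rewrite /lo /hi lexx => /ltW.
Qed.

Lemma dyadic_bisect (R : realType) (l : nat) (r : 'I_l) (d : 'I_l -> nat)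
    (x y : box R l) :
  dyadic_box d x -> y \in bisect r x ->
  dyadic_box (fun i => d i + (i == r))%N y.
Proof.
move=> dx; have pr := dyadic_proper dx r; case: dx => xu hx.
rewrite !inE => /orP[] /eqP ->; split=> [z zx|i].
1,3: apply: xu => i; have := zx i.
1,2: rewrite /lo /hi /set_coord /= mxE; case: eqP => // ->.
1,2: by move: pr; rewrite /lo /hi; lra.
all: have := hx i; rewrite /lo /hi /set_coord /= mxE.
all: case: eqP => [-> | _]; last by rewrite addn0.
all: by rewrite addn1 exprSr invfM => <-; field.
Qed.

Lemma bisect_cover (R : realType) (l : nat) (r : 'I_l) (x : box R l)
    (z : 'rV[R]_l) :
  box_set x z -> exists2 y, y \in bisect r x & box_set y z.
Proof.
move=> zx; set mid := (lo x r + hi x r) / 2.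
have [zr|/ltW zr] := leP (z 0 r) mid.
  exists (x.1, set_coord x.2 r mid); first by rewrite !inE eqxx.
  move=> i; have := zx i; rewrite /lo /hi /set_coord /= mxE.
  by case: eqP => // -> /andP[-> _].
exists (set_coord x.1 r mid, x.2); first by rewrite !inE eqxx orbT.
move=> i; have := zx i; rewrite /lo /hi /set_coord /= mxE.
by case: eqP => // -> /andP[_ ->]; rewrite zr.
Qed.

(** * A box around the minimizer survives *)

Section Pcba.
Variables (R : realType) (l : nat) (p : mpoly.mpoly l R) (zeta : R).
Hypothesis hl : (0 < l)%N.
Hypothesis hzeta : range_error_constant p zeta.

(** The range-error property bounds the infimum and the supremum of [p] over
    [x]; boundedness of [p] on the unit box makes these genuine bounds for the
    values of [p]. *)
Lemma patch_encloses (d : 'I_l -> nat) (x : box R l) (y : 'rV[R]_l) :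
  dyadic_box d x -> box_set x y ->
  min_patch p x <= peval p y <= max_patch p x.
Proof.
move=> dx xy; have xu := dx.1; have [n wx] := dyadic_width_pow hl dx.
have [mlo _ _ mhi] := hzeta.2 n x (dyadic_proper dx) xu wx.
have [c [_ cmin]] := ex_optimal_solution p.
have [M Mmax] := peval_unit_box_bounded p.
apply/andP; split.
  apply: le_trans mlo _; apply: ge_inf; last by exists y.
  by exists (peval p c) => _ [z zx <-]; apply/cmin/xu.
apply: le_trans mhi; apply: ub_le_sup; last by exists y.
by exists M => _ [z zx <-]; apply/Mmax/xu.
Qed.

(** Each box contributes a value of [p] below its largest coefficient; its
    lower corner is a convenient point. *)
Lemma optimum_le_p_up (d : 'I_l -> nat) (Q : seq (box R l)) (c : 'rV[R]_l) :
  Q != [::] -> (forall x, x \in Q -> dyadic_box d x) ->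
  optimal_solution p c -> peval p c <= p_up p Q.
Proof.
move=> Q0 dQ [_ cmin]; apply: le_seq_min; first by case: Q Q0 {dQ}.
move=> _ /mapP[x /dQ dx ->].
have /andP[_] := patch_encloses dx (dyadic_lower_corner dx).
by apply: le_trans; apply/cmin/dx.1/(dyadic_lower_corner dx).
Qed.

(** The loop invariant.  One exponent vector serves the whole list, since all
    boxes are bisected in the same direction at the same time. *)
Definition grid_around (c : 'rV[R]_l) (d : 'I_l -> nat) (Q : seq (box R l)) :
    Prop :=
  (forall x, x \in Q -> dyadic_box d x) /\ exists2 x, x \in Q & box_set x c.

Lemma grid_around_bisect (c : 'rV[R]_l) (d : 'I_l -> nat)
    (Q : seq (box R l)) (r : 'I_l) :
  grid_around c d Q ->
  grid_around c (fun i => d i + (i == r))%N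
    (flatten [seq bisect r x | x <- Q]).
Proof.
move=> [dQ [x xQ xc]]; split.
  by move=> y /flattenP[_ /mapP[z zQ ->]]; apply: dyadic_bisect; exact: dQ.
have [y yx yc] := bisect_cover r xc; exists y => //.
by apply/flattenP; exists (bisect r x) => //; apply/mapP; exists x.
Qed.

Lemma grid_around_cut_off (c : 'rV[R]_l) (d : 'I_l -> nat)
    (Q : seq (box R l)) :
  optimal_solution p c -> grid_around c d Q -> grid_around c d (cut_off p Q).
Proof.
move=> copt [dQ [x xQ xc]]; split.
  by move=> y; rewrite mem_filter => /andP[_ /dQ].
exists x => //; rewrite mem_filter xQ andbT -leNgt.
have /andP[+ _] := patch_encloses (dQ x xQ) xc; move=> /le_trans; apply.
by apply: (optimum_le_p_up _ dQ copt); apply: contraTneq xQ => ->.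
Qed.

(** Stated for an arbitrary list of directions so that the induction on the
    fold goes through; each direction of the list halves its side once per
    occurrence. *)
Lemma grid_around_sweep (c : 'rV[R]_l) (d : 'I_l -> nat)
    (Q : seq (box R l)) (s : seq 'I_l) :
  optimal_solution p c -> grid_around c d Q ->
  grid_around c (fun i => d i + count_mem i s)%N
    (foldl (fun Q' r => cut_off p (flatten [seq bisect r x | x <- Q'])) Q s).
Proof.
move=> copt; elim: s d Q => [|r s IH] d Q gQ /=.
  by under eq_fun do rewrite addn0.
under eq_fun do rewrite (eq_sym r) addnA.
exact/IH/grid_around_cut_off/grid_around_bisect.
Qed.

Lemma grid_around_pcba_list (c : 'rV[R]_l) (n : nat) :
  optimal_solution p c -> grid_around c (fun=> n) (pcba_list p n).
Proof.
move=> copt; elim: n => [|n IH] /=.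
  split=> [x|]; last by exists (unit_box R l); [exact: mem_head|exact: copt.1].
  rewrite inE => /eqP ->; split=> // i.
  by rewrite /hi /lo /= !mxE subr0 expr0 invr1.
have := grid_around_sweep (enum 'I_l) copt IH.
by under eq_fun do rewrite count_uniq_mem ?enum_uniq// mem_enum addn1.
Qed.

(** The box around the minimizer is the witness: both the largest coefficient
    there and the smallest coefficient of any other box are compared with the
    optimal value. *)
Lemma stopping_criterion_fine_grid (L eps delta : R) (n : nat) :
  lipschitz_constant p L -> 2 ^- n <= delta ->
  4 * zeta * 2 ^- (2 * n) <= eps -> 2 * L * Num.sqrt l%:R * 2 ^- n <= eps ->
  stopping_criterion p eps delta (pcba_list p n).
Proof.
move=> [L0 lip] ndelta nzeta nL.
have [c copt] := ex_optimal_solution p.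
have [dQ [x xQ xc]] := grid_around_pcba_list n copt.
have wQ y : y \in pcba_list p n -> width y = 2 ^- n.
  by move=> /dQ dy; rewrite (dyadic_width (i0 := Ordinal hl) dy).
have boundQ y (yQ : y \in pcba_list p n) := hzeta.2 n y
  (dyadic_proper (dQ y yQ)) (dQ y yQ).1 (wQ y yQ).
exists x; split; rewrite ?wQ// => y yQ.
have [_ _ xmax _] := boundQ x xQ.
have [_ ymin _ _] := boundQ y yQ.
have supx : sup (peval p @` box_set x) <=
    peval p c + L * (2 ^- n * Num.sqrt l%:R).
  apply: ge_sup; first by exists (peval p c), c.
  move=> _ [z xz <-]; rewrite -lerBlDl; apply: le_trans (ler_norm _) _.
  apply: le_trans (lip _ _ ((dQ x xQ).1 _ xz) copt.1) _.
  apply: ler_wpM2l => //; apply: le_norm2 => [|i].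
    by rewrite invr_ge0 exprn_ge0.
  (* Each coordinate of [z] and of [c] lies in the same side of [x]. *)
  have := (dQ x xQ).2 i => <-; rewrite !mxE ler_norml.
  by have := xz i; have := xc i; lra.
have infy : peval p c <= inf (peval p @` box_set y).
  apply: lb_le_inf.
    by exists (peval p y.1), y.1 => //; exact: dyadic_lower_corner (dQ y yQ).
  by move=> _ [z yz <-]; apply/copt.2/(dQ y yQ).1.
move: (2 ^- (2 * n)) (2 ^- n) nzeta nL xmax ymin supx infy => *; lra.
Qed.

End Pcba.

(** * The iteration bound *)

Lemma elog2_div (R : realType) (a b : R) :
  0 < a -> 0 <= b ->
  elog2 (a%:E / b%:E) =
  if b == 0 then +oo%E else ((ln a - ln b) / ln 2)%:E.
Proof.
have ln2 : 0 < (ln (2 : R))^-1 by rewrite invr_gt0 ln_gt0// ltr1n.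
move=> a0; rewrite le_eqVlt => /predU1P[<-|b0].
  by rewrite eqxx inver eqxx /elog2 gt0_muley ?lte_fin//= gt0_mulye ?lte_fin.
rewrite gt_eqF// inver gt_eqF// -EFinM /elog2 lne_EFin ?divr_gt0//.
by rewrite -EFinM ln_div.
Qed.

(** A logarithmic condition on [n] is turned into the inequality it encodes.
    For [b = 0] the quotient is [+oo], the condition reads [-oo <= n], and the
    inequality holds as well. *)
Lemma mul_exp2_le_of_elog2 (R : realType) (a b : R) (n : nat) :
  0 < a -> 0 <= b -> (- elog2 (a%:E / b%:E) <= n%:R%:E)%E ->
  b * 2 ^- n <= a.
Proof.
move=> a0 b0; rewrite elog2_div//; case: eqVneq => [->|bn0].
  by rewrite mul0r => _; exact: ltW.
move=> le_n; have {bn0}b0 : 0 < b by rewrite lt_neqAle eq_sym bn0.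
have ln2 : 0 < ln (2 : R) by rewrite ln_gt0// ltr1n.
move: le_n; rewrite -EFinN lee_fin -mulNr opprB ler_pdivrMr// lerBlDr.
rewrite mulr_natl -lnXn// -lnM ?posrE ?exprn_gt0//.
rewrite ler_ln ?posrE ?mulr_gt0 ?exprn_gt0//.
by rewrite ler_pdivrMr ?exprn_gt0// mulrC.
Qed.

Lemma pcba_bound_le (R : realType) (l n : nat) (zeta L eps delta : R) :
  0 <= zeta -> 0 <= L -> 0 < eps -> 0 < delta ->
  pcba_bound l zeta L eps delta <= n%:Z ->
  [/\ 2 ^- n <= delta, 4 * zeta * 2 ^- (2 * n) <= eps &
      2 * L * Num.sqrt l%:R * 2 ^- n <= eps].
Proof.
move=> zeta0 L0 eps0 delta0; rewrite /pcba_bound ceil_le_int.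
have z0 : 0 <= 4 * zeta by rewrite mulr_ge0.
have s0 : 0 <= 2 * L * Num.sqrt l%:R by rewrite !mulr_ge0// sqrtr_ge0.
have -> : delta%:E = (delta%:E / 1%:E)%E by rewrite inver oner_eq0 invr1 mule1.
set M := maxe _ _.
(* [fine] sends infinite values to [0], so finiteness has to be checked: the
   first term is finite and no term is [+oo]. *)
have M_fin : M \is a fin_num.
  rewrite fin_numElt lt_max !gt_max !elog2_div// oner_eq0 -EFinN ltNyr ltry/=.
  have half0 : (0 < (2^-1 : R)%:E)%E by rewrite lte_fin.
  by do 2!case: ifP => _; rewrite ?gt0_muley//= ?ltNyy -?EFinM -?EFinN ?ltry.
move=> Mn; have : (M <= n%:R%:E)%E by rewrite -(fineK M_fin) lee_fin.
rewrite !ge_max => /and3P[Mdelta Mzeta ML]; split.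
- by rewrite -[leLHS]mul1r; apply: mul_exp2_le_of_elog2.
- (* The factor [1/2] is absorbed by the exponent [2 * n]. *)
  apply: mul_exp2_le_of_elog2 => //; move: Mzeta; rewrite elog2_div//.
  case: ifP => _; rewrite ?leNye// -EFinM -!EFinN !lee_fin natrM; lra.
- exact: mul_exp2_le_of_elog2.
Qed.

Theorem theorem14 (R : realType) (l : nat) (p : mpoly.mpoly l R)
    (L zeta eps delta : R)
    (hl : (0 < l)%N)
    (hL : lipschitz_constant p L)
    (hzeta : range_error_constant p zeta)
    (hint : forall x : 'rV[R]_l, optimal_solution p x ->
              ~ boundary (box_set (unit_box R l)) x)
    (heps : 0 < eps)
    (hdelta : 0 < delta) :
  exists T : nat,
    pcba_iterations p eps delta T /\
    T%:Z <= Num.max 0 (pcba_bound l zeta L eps delta).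
Proof.
(* The positive part of the bound is the natural number of iterations that
   certainly suffices. *)
pose N := Num.max 0 (pcba_bound l zeta L eps delta).
have [n defN] : exists n, N = n%:Z.
  by exists `|N|%N; rewrite gez0_abs// le_max lexx.
have [nd nz nL] : [/\ 2 ^- n <= delta, 4 * zeta * 2 ^- (2 * n) <= eps &
    2 * L * Num.sqrt l%:R * 2 ^- n <= eps].
  apply: (pcba_bound_le hzeta.1 hL.1 heps hdelta).
  by rewrite -defN /N le_max lexx orbT.
have stop_n : `[< stopping_criterion p eps delta (pcba_list p n) >].
  by apply/asboolP; exact: (stopping_criterion_fine_grid hl hzeta hL nd nz nL).
have ex_stop : exists k, `[< stopping_criterion p eps delta (pcba_list p k) >].
  by exists n.
case: (ex_minnP ex_stop) => T /asboolP stopT minT.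
exists T; split; last by rewrite -/N defN lez_nat minT.
split=> // k kT /asboolP stop_k.
by have := minT k stop_k; rewrite leqNgt kT.
Qed.
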